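(* Let $\mathbb{K}\in\{\mathbb{R},\mathbb{C}\}$, let $m,N\geq 1$ be integers, let $u_1,\ldots,u_N\in\mathbb{K}^m$ be unit vectors, and let $w_1,\ldots,w_N\in\mathbb{R}$. Then, for every integer $t\geq 1$, $$\sum_{i,j=1}^N w_iw_j|\langle u_i,u_j\rangle|^{2t}\;\geq\;\frac{2t-1}{m+2t-2}\sum_{i,j=1}^N w_iw_j|\langle u_i,u_j\rangle|^{2t-2}\qquad\text{if }\mathbb{K}=\mathbb{R},$$ and $$\sum_{i,j=1}^N w_iw_j|\langle u_i,u_j\rangle|^{2t}\;\geq\;\frac{t}{m+t-1}\sum_{i,j=1}^N w_iw_j|\langle u_i,u_j\rangle|^{2t-2}\qquad\text{if }\mathbb{K}=\mathbb{C}.$$ Moreover, for a fixed integer $t\geq 1$, equality holds in the inequality corresponding to $\mathbb{K}$ if and only if $$\sum_{i=1}^N w_i|\langle u_i,x\rangle|^{2t}=c_t(m,\mathbb{K})\Big(\sum_{i=1}^N w_i\Big)\|x\|^{2t}\qquad\text{for all }x\in\mathbb{K}^m,$$ where $$c_t(m,\mathbb{R})=\frac{1\cdot 3\cdots(2t-1)}{m(m+2)\cdots(m+2t-2)},\qquad c_t(m,\mathbb{C})=\frac{1}{\binom{m+t-1}{t}}.$$ In this case, for every integer $s$ with $1\leq s\leq t$, $$\sum_{i=1}^N w_i|\langle u_i,x\rangle|^{2s}=c_s(m,\mathbb{K})\Big(\sum_{i=1}^N w_i\Big)\|x\|^{2s}\qquad\text{for all }x\in\mathbb{K}^m.$$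
   Context: $\langle\cdot,\cdot\rangle$ and $\|\cdot\|$ denote the standard inner product and Euclidean norm on $\mathbb{K}^m$. The coefficients $w_i$ are arbitrary real numbers (they may be negative or zero). A zeroth power is understood to be $1$, including $0^0=1$; so for $t=1$ the sum on the right-hand side of each inequality is $\big(\sum_i w_i\big)^2$. *)

(* Defs.v *)
From mathcomp Require Import all_boot all_order all_algebra.
From mathcomp Require Import reals complex.
Set Implicit Arguments.
Unset Strict Implicit.
Unset Printing Implicit Defensive.
Import Order.TTheory GRing.Theory Num.Theory.
Local Open Scope ring_scope.

Section RealSpace.
Variables (R : realType) (m : nat).
Implicit Types u v x : 'rV[R]_m.

Definition rdot u v : R := \sum_(k < m) u 0 k * v 0 k.

Definition rnorm x : R := Num.sqrt (rdot x x).

Definition rconst (t : nat) : R :=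
  (\prod_(k < t) (2 * k + 1)%:R) / \prod_(k < t) (m + 2 * k)%:R.

End RealSpace.

Section ComplexSpace.
Variables (R : realType) (m : nat).
Implicit Types u v x : 'rV[R[i]]_m.

(* [dotmx u v] is the sum of the [u 0 k * (v 0 k)^*]; moduli and norms are
   taken in [R], not in [R[i]], so that they can be compared as reals. *)
Definition cdot_abs u v : R := ComplexField.Normc.normc (dotmx u v).

Definition cnorm x : R := Num.sqrt (complex.Re (dotmx x x)).

Definition cconst (t : nat) : R := ('C(m + t - 1, t))%:R^-1.

End ComplexSpace.

Arguments rconst R m t : clear implicits.
Arguments cconst R m t : clear implicits.

(* Main.v *)
Require Import Defs.
From mathcomp Require Import all_boot all_order all_algebra.
From mathcomp Require Import reals complex.
From mathcomp Require Import ring zify.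
Set Implicit Arguments.
Unset Strict Implicit.
Unset Printing Implicit Defensive.
Import Order.TTheory GRing.Theory Num.Theory.
Local Open Scope ring_scope.

(* The tensors of the polynomials F_t(x) = sum_i w_i |<u_i, x>|^(2t) have squared
   norm S_t = sum_ij w_i w_j |<u_i, u_j>|^(2t), and the Laplacian sends F_t to a
   multiple of F_(t-1).  In the real case put a_t = t (2 t - 1),
   e_t = t (m + 2 t - 2) (in the complex case a_t = 2 t^2,
   e_t = 2 t (m + t - 1)); since multiplication by |x|^2 is adjoint to the
   Laplacian, expanding
     || F_t - (a_t / e_t) |x|^2 F_(t-1) ||^2 >= 0
   gives, for G_t = e_t S_t - a_t S_(t-1), the recursion
     G_t = e_t || F_t - (a_t / e_t) |x|^2 F_(t-1) ||^2 + (a_t / e_t) G_(t-1).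
   Hence G_t >= 0, and G_t = 0 forces F_s = (a_s / e_s) |x|^2 F_(s-1) for all
   s <= t.  Conversely the Laplacian of the identity of order t is the identity
   of order t - 1, and both together give the two moments S_t and S_(t-1). *)

(** * Coefficients of polynomials from values and for powers of quadratics *)

(** The nodes [0, ..., n - 1] are distinct, so their Vandermonde matrix is invertible and column
    [j0] of its inverse holds the weights. Second derivatives thereby become finite combinations of
    values. *)
Lemma coef_as_evaluations (R : numFieldType) (n j0 : nat) : (j0 < n)%N ->
  exists c : 'I_n -> R, forall p : {poly R}, (size p <= n)%N ->
    \sum_l c l * p.[l%:R] = p`_j0.
Proof.
move=> lt_j0; pose a : 'rV[R]_n := \row_l l%:R.
have Vu : Vandermonde n a \in unitmx.
  rewrite unitmxE det_Vandermonde unitfE prodf_seq_neq0.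
  apply/allP => i _ /=; rewrite prodf_seq_neq0; apply/allP => j _ /=.
  apply/implyP => lt_ij; rewrite !mxE subr_eq0 eqr_nat.
  by rewrite gtn_eqF.
pose j1 := Ordinal lt_j0; exists (fun l => invmx (Vandermonde n a) l j1) => p sp.
under eq_bigr => l _ do rewrite (horner_coef_wide _ sp) mulr_sumr.
rewrite exchange_big (bigD1 j1) //= [X in _ + X]big1 => [|j ne_j].
  have /matrixP/(_ j1 j1) := mulmxV Vu; rewrite !mxE eqxx mulr1n => e.
  rewrite addr0 -[RHS]mulr1 -[X in _ * X]e mulr_sumr; apply: eq_bigr => l _.
  by rewrite !mxE; ring.
have /matrixP/(_ j j1) := mulmxV Vu; rewrite !mxE (negPf ne_j) mulr0n => e.
rewrite -[RHS](mulr0 p`_j) -[X in _ * X]e mulr_sumr; apply: eq_bigr => l _.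
by rewrite !mxE; ring.
Qed.

Section LowCoefficients.
Variable R : comNzRingType.
Implicit Types p q : {poly R}.

Lemma coef1M p q : (p * q)`_1 = p`_0 * q`_1 + p`_1 * q`_0.
Proof. by rewrite coefM !big_ord_recl big_ord0 /= addr0. Qed.

Lemma coef2M p q : (p * q)`_2 = p`_0 * q`_2 + p`_1 * q`_1 + p`_2 * q`_0.
Proof. by rewrite coefM !big_ord_recl big_ord0 /= addr0 addrA. Qed.

Lemma coef0_exp p a : (p ^+ a)`_0 = p`_0 ^+ a.
Proof. by rewrite -!horner_coef0 horner_exp. Qed.

Lemma coef1_exp p a : (p ^+ a)`_1 = a%:R * p`_0 ^+ a.-1 * p`_1.
Proof.
elim: a => [|a IH]; first by rewrite expr0 coef1 !mul0r.
rewrite exprSr coef1M IH coef0_exp.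
by case: a {IH} => [|a] /=; rewrite ?exprS -?natr1; ring.
Qed.

(** Degree two arises from one factor's quadratic term or from two factors' linear terms. The
    exponents [a.-1] and [a.-2] truncate only where the multiplier in front is zero. *)
Lemma coef2_exp p a : (p ^+ a)`_2 =
  a%:R * p`_0 ^+ a.-1 * p`_2 + 'C(a, 2)%:R * p`_0 ^+ a.-2 * p`_1 ^+ 2.
Proof.
elim: a => [|a IH]; first by rewrite expr0 coef1 bin0n !mul0r addr0.
rewrite exprSr coef2M IH coef1_exp coef0_exp binS bin1 natrD.
case: a {IH} => [|[|a]] /=;
  by rewrite ?bin0n ?(@bin_small 1 2) //= -?natr1 ?exprS; ring.
Qed.

End LowCoefficients.

Definition quad_poly (R : comNzRingType) (a b c : R) : {poly R} :=
  Poly [:: a; b; c].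

(** The two quadratics are [nrm2] and [K u] restricted to a line, so this is half the second
    directional derivative of [nrm2 ^+ i * K u ^+ j]. *)
Lemma coef_quad_powers (R : numFieldType) (q x k b c : R) (i j : nat) :
  (quad_poly q (2 * x) 1 ^+ i * quad_poly k (2 * b) c ^+ j)`_2 =
    i%:R * q ^+ i.-1 * k ^+ j
    + 2 * i%:R * (i%:R - 1) * q ^+ i.-2 * k ^+ j * x ^+ 2
    + 4 * i%:R * j%:R * q ^+ i.-1 * k ^+ j.-1 * (x * b)
    + j%:R * q ^+ i * k ^+ j.-1 * c
    + 2 * j%:R * (j%:R - 1) * q ^+ i * k ^+ j.-2 * b ^+ 2.
Proof.
have bin2R m : 'C(m, 2)%:R = m%:R * (m%:R - 1) / 2 :> R.
  apply: (mulIf (x := 2)); first by rewrite pnatr_eq0.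
  rewrite divfK ?pnatr_eq0 // -natrM mulnC -mul_bin_diag bin1 natrM.
  by case: m => [|m] /=; rewrite -?natr1; ring.
rewrite coef2M !coef2_exp !coef1_exp !coef0_exp !bin2R !coef_Poly /=.
by field.
Qed.

(** * The Laplacian on powers of an abstract kernel *)

Section KernelDesigns.
Variables (R : realFieldType) (X : Type) (A I : finType).
Variables (phi : A -> X -> R) (nrm2 : X -> R) (shift : I -> R -> X -> X).
Variables (xi : I -> X -> R) (beta : I -> X -> X -> R) (gam : I -> X -> R).
Variables (K : X -> X -> R) (n c : R).

(* [K u x] stands for [|<u, x>| ^ 2] and [nrm2 x] for [|x| ^ 2]; [shift k s]
   translates by [s] in the [k]-th direction of a real orthonormal basis of the
   space.  [(n, c)] is [(m, 1)] in the real case and [(2 * m, 2)] in the complex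
   one. *)
Hypothesis K_features : forall x y, K x y = \sum_a phi a x * phi a y.
Hypothesis card_I : #|I|%:R = n.
Hypothesis n_gt0 : 0 < n.
Hypothesis c_gt0 : 0 < c.
Hypothesis nrm2_shift : forall k s x,
  nrm2 (shift k s x) = nrm2 x + 2 * xi k x * s + s ^+ 2.
Hypothesis K_shift : forall k s u x,
  K u (shift k s x) = K u x + 2 * beta k u x * s + gam k u * s ^+ 2.
Hypothesis sum_xi2 : forall x, \sum_k xi k x ^+ 2 = nrm2 x.
Hypothesis sum_xi_beta : forall u x, \sum_k xi k x * beta k u x = K u x.
Hypothesis sum_beta2 : forall u x, \sum_k beta k u x ^+ 2 = nrm2 u * K u x.
Hypothesis sum_gam : forall u, \sum_k gam k u = c * nrm2 u.

Let Ksym x y : K x y = K y x.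
Proof. by rewrite !K_features; apply: eq_bigr => a _; rewrite mulrC. Qed.

(** For any weights this only combines values at translates, so it is linear on all functions;
    suitable weights make it half the Laplacian. *)
Let lap d (wt : 'I_d -> R) (f : X -> R) x :=
  \sum_k \sum_l wt l * f (shift k l%:R x).

Let lap_sum d (wt : 'I_d -> R) (J : finType) (b : J -> R) (F : J -> X -> R) f x :
  (forall y, f y = \sum_j b j * F j y) ->
  lap wt f x = \sum_j b j * lap wt (F j) x.
Proof.
move=> fE; rewrite /lap.
under [RHS]eq_bigr => j _ do rewrite mulr_sumr.
rewrite [RHS]exchange_big; apply: eq_bigr => k _ /=.
under [RHS]eq_bigr => j _ do rewrite mulr_sumr.
rewrite [RHS]exchange_big; apply: eq_bigr => l _ /=.
by rewrite fE mulr_sumr; apply: eq_bigr => j _; ring.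
Qed.

(* Half the Laplacian: the sum over the directions of the coefficients of
   [s ^+ 2], each being a fixed combination of values because the functions
   below have degree at most [2 * t] along a line. *)
Let half_laplacian t : (0 < t)%N ->
  exists d, exists wt : 'I_d -> R, forall i j u x, (i + j = t)%N ->
    lap wt (fun y => nrm2 y ^+ i * K u y ^+ j) x =
      i%:R * (n + 2 * (i%:R - 1) + 4 * j%:R) * (nrm2 x ^+ i.-1 * K u x ^+ j)
      + j%:R * (c + 2 * (j%:R - 1)) * nrm2 u * (nrm2 x ^+ i * K u x ^+ j.-1).
Proof.
move=> t_gt0.
have lt2 : (2 < (2 * t).+1)%N by rewrite ltnS; case: t t_gt0 => // t _; rewrite mulnS.
have [wt wtP] := coef_as_evaluations R lt2.
exists (2 * t).+1, wt => i j u x eq_t; rewrite /lap.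
pose p k := quad_poly (nrm2 x) (2 * xi k x) 1 ^+ i *
            quad_poly (K u x) (2 * beta k u x) (gam k u) ^+ j.
transitivity (\sum_k (p k)`_2).
  apply: eq_bigr => k _; rewrite -wtP.
    apply: eq_bigr => l _; rewrite nrm2_shift K_shift /p hornerM !horner_exp.
    rewrite !horner_Poly /=; congr (_ * (_ ^+ _ * _ ^+ _)); ring.
  have szX (a b g : R) e : (size (quad_poly a b g ^+ e) <= (2 * e).+1)%N.
    apply: leq_trans (size_poly_exp_leq _ _) _.
    by rewrite ltnS leq_mul2r -subn1 leq_subLR (size_Poly [:: a; b; g]) orbT.
  apply: leq_trans (size_polyMleq _ _) _.
  rewrite -eq_t mulnDr -subn1 leq_subLR add1n -addnS -addSn.
  exact: leq_add (szX _ _ _ _) (szX _ _ _ _).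
under eq_bigr => k _ do rewrite coef_quad_powers.
rewrite !big_split /= -!mulr_sumr sum_xi2 sum_xi_beta sum_beta2 sum_gam.
rewrite sumr_const -[_ *+ #|_|]mulr_natr card_I.
(* Summing [xi ^+ 2] gives back one power of [nrm2 x], turning exponent [i.-2] into [i.-1]. This
   fails for [i <= 1], where the coefficient vanishes; hence the case split, and likewise for
   [j]. *)
by clear p; case: i j eq_t => [|[|i]] [|[|j]] _ /=; rewrite ?exprS -?natr1; ring.
Qed.

(** Distributivity: the features of the power are the tensor power of [phi], indexed by words of
    length [t]. *)
Let K_power t x y : K x y ^+ t =
  \sum_(f : {ffun 'I_t -> A}) (\prod_i phi (f i) x) * (\prod_i phi (f i) y).
Proof.
rewrite K_features -[t in LHS]card_ord -prodr_const bigA_distr_bigA.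
by apply: eq_bigr => f _; rewrite big_split.
Qed.

(** * Weighted unit points: the recursion and the equality case *)

Section Points.
Variables (N : nat) (u : 'I_N -> X) (w : 'I_N -> R).
Hypothesis u_unit : forall i, nrm2 (u i) = 1.

Let F t x := \sum_i w i * K (u i) x ^+ t.
Let S t := \sum_i \sum_j w i * w j * K (u i) (u j) ^+ t.
Let W := \sum_i w i.
(** Half the Laplacian sends [K u ^+ t] to [a t * K u ^+ t.-1] for unit [u], and [nrm2 ^+ t] to
    [e t * nrm2 ^+ t.-1]; [C t] is the product of the ratios [a / e] up to order [t]. *)
Let a t : R := t%:R * (c + 2 * (t%:R - 1)).
Let e t : R := t%:R * (n + 2 * (t%:R - 1)).
Let C t : R := \prod_(k < t) ((c + 2 * k%:R) / (n + 2 * k%:R)).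

Let a_gt0 t : 0 < a t.+1.
Proof.
apply: mulr_gt0; first by rewrite ltr0n.
by rewrite -[t.+1%:R]natr1 addrK ltr_wpDr // mulr_ge0 ?ler0n.
Qed.

Let e_gt0 t : 0 < e t.+1.
Proof.
apply: mulr_gt0; first by rewrite ltr0n.
by rewrite -[t.+1%:R]natr1 addrK ltr_wpDr // mulr_ge0 ?ler0n.
Qed.

Let CS t : C t.+1 * e t.+1 = C t * a t.+1.
Proof.
rewrite /C big_ord_recr /= /e /a -[t.+1%:R]natr1 addrK.
have : n + 2 * t%:R != 0 by rewrite gt_eqF // ltr_wpDr // mulr_ge0 ?ler0n.
by move=> nz; field.
Qed.

Let SF t : \sum_i w i * F t (u i) = S t.
Proof.
apply: eq_bigr => i _; rewrite mulr_sumr; apply: eq_bigr => j _.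
by rewrite Ksym; ring.
Qed.

(** The same weights serve all four functions, which have common order [t.+1]. The factor
    [e t.+1 - e t] is [n + 4 * t]; at [t = 0] the spurious [F t.-1] is killed by [a 0 = 0]. *)
Let lap_F t : exists d, exists wt : 'I_d -> R, [/\
  forall u x, lap wt (fun y => K u y ^+ t.+1) x = a t.+1 * nrm2 u * K u x ^+ t,
  forall x, lap wt (F t.+1) x = a t.+1 * F t x,
  forall x, lap wt (fun y => nrm2 y * F t y) x =
     (e t.+1 - e t) * F t x + a t * (nrm2 x * F t.-1 x)
  & forall x, lap wt (fun y => nrm2 y ^+ t.+1) x = e t.+1 * nrm2 x ^+ t].
Proof.
have [d [wt wtP]] := half_laplacian (ltn0Sn t); exists d, wt.
have lapK v x : lap wt (fun y => K v y ^+ t.+1) x = a t.+1 * nrm2 v * K v x ^+ t.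
  transitivity (lap wt (fun y => nrm2 y ^+ 0 * K v y ^+ t.+1) x).
    by apply: eq_bigr => k _; apply: eq_bigr => l _; rewrite expr0 mul1r.
  by rewrite wtP // /a /=; ring.
split=> // x.
- rewrite (@lap_sum _ _ _ w (fun i y => K (u i) y ^+ t.+1)) //.
  rewrite mulr_sumr; apply: eq_bigr => i _.
  by rewrite lapK u_unit; ring.
- rewrite (@lap_sum _ _ _ w (fun i y => nrm2 y ^+ 1 * K (u i) y ^+ t)).
    rewrite !mulr_sumr -big_split /=; apply: eq_bigr => i _.
    rewrite wtP // u_unit /a /e /= -[t.+1%:R]natr1; ring.
  by move=> y; rewrite mulr_sumr; apply: eq_bigr => i _; ring.
- transitivity (lap wt (fun y => nrm2 y ^+ t.+1 * K x y ^+ 0) x).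
    by apply: eq_bigr => k _; apply: eq_bigr => l _; rewrite expr0 mulr1.
  by rewrite wtP ?addn0 // /e /=; ring.
Qed.

Let feature t (f : {ffun 'I_t -> A}) x := \prod_i phi (f i) x.

(* [P] is the tensor of [F t.+1 - (a t.+1 / e t.+1) * nrm2 * F t], and
   expanding its squared norm gives the recursion. *)
Let excess_rec t : exists P : {ffun 'I_t.+1 -> A} -> R,
  e t.+1 * S t.+1 - a t.+1 * S t =
    e t.+1 * (\sum_f P f ^+ 2) + a t.+1 / e t.+1 * (e t * S t - a t * S t.-1)
  /\ forall x, \sum_f P f * feature f x =
       F t.+1 x - a t.+1 / e t.+1 * (nrm2 x * F t x).
Proof.
have [d [wt [lapK lapF lapqF _]]] := lap_F t.
pose Af (f : {ffun 'I_t.+1 -> A}) := \sum_i w i * feature f (u i).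
(* Pairing a tensor with [Bf] applies [lap] to its polynomial and sums over the points. This is the
   adjointness, with no need to multiply tensors by [nrm2] explicitly. *)
pose Bf (f : {ffun 'I_t.+1 -> A}) := \sum_i w i * lap wt (feature f) (u i).
have AF x : \sum_f Af f * feature f x = F t.+1 x.
  under eq_bigr => f _ do rewrite mulr_suml.
  rewrite exchange_big; apply: eq_bigr => i _; rewrite K_power mulr_sumr.
  by apply: eq_bigr => f _; rewrite mulrA.
have sumB (g : {ffun 'I_t.+1 -> A} -> R) G :
    (forall x, G x = \sum_f g f * feature f x) ->
  \sum_f g f * Bf f = \sum_i w i * lap wt G (u i).
  move=> GE; under eq_bigr => f _ do rewrite mulr_sumr.
  rewrite exchange_big; apply: eq_bigr => i _ /=.
  rewrite (lap_sum wt (u i) GE) mulr_sumr.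
  by apply: eq_bigr => f _; ring.
(* Evaluation at [x] is pairing with the tensor of [K x ^+ t.+1], whose half Laplacian produces the
   factor [nrm2 x]. *)
have BF x : \sum_f Bf f * feature f x = a t.+1 * (nrm2 x * F t x).
  under eq_bigr => f _ do rewrite mulrC.
  rewrite (sumB (fun f => feature f x) (fun y => K x y ^+ t.+1)); last by move=> y; exact: K_power.
  rewrite !mulr_sumr; apply: eq_bigr => i _.
  by rewrite lapK [K x _]Ksym; ring.
have AA : \sum_f Af f * Af f = S t.+1.
  under eq_bigr => f _ do rewrite {2}/Af mulr_sumr.
  rewrite exchange_big -SF; apply: eq_bigr => i _ /=.
  by rewrite -AF mulr_sumr; apply: eq_bigr => f _; ring.
have AB : \sum_f Af f * Bf f = a t.+1 * S t.
  rewrite (sumB _ (F t.+1)) // -SF mulr_sumr.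
  by apply: eq_bigr => i _; rewrite lapF; ring.
have BB : \sum_f Bf f * Bf f = a t.+1 * ((e t.+1 - e t) * S t + a t * S t.-1).
  rewrite (sumB _ (fun y => \sum_f Bf f * feature f y)) // -!SF.
  rewrite !mulr_sumr -big_split mulr_sumr; apply: eq_bigr => i _ /=.
  rewrite (@lap_sum _ _ 'I_1 (fun=> a t.+1)
            (fun=> fun y => nrm2 y * F t y)); last first.
    by move=> y; rewrite big_ord1 BF.
  by rewrite big_ord1 lapqF u_unit; ring.
have e_neq0 : e t.+1 != 0 by rewrite gt_eqF.
exists (fun f => Af f - Bf f / e t.+1); split=> [|x].
  have -> : \sum_f (Af f - Bf f / e t.+1) ^+ 2 =
      \sum_f Af f * Af f - 2 / e t.+1 * (\sum_f Af f * Bf f)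
      + (e t.+1) ^- 2 * (\sum_f Bf f * Bf f).
    rewrite !mulr_sumr -sumrN -!big_split; apply: eq_bigr => f _ /=.
    by field.
  by rewrite AA AB BB; field.
rewrite -AF mulrAC -BF mulr_suml -sumrB.
by apply: eq_bigr => f _; ring.
Qed.

(** Induction along [excess_rec], starting at zero because [e 0 = a 0 = 0]. *)
Let excess_ge0 t : 0 <= e t * S t - a t * S t.-1.
Proof.
elim: t => [|t IH]; first by rewrite /e /a !mul0r subrr.
have [P [-> _]] := excess_rec t.
apply: addr_ge0; apply: mulr_ge0 => //; first by rewrite ltW.
  by apply: sumr_ge0 => f _; rewrite sqr_ge0.
by rewrite divr_ge0 // ltW.
Qed.

(** Both nonnegative terms of the recursion vanish: [P = 0] expresses [F t.+1] through [nrm2 * F t],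
    and the zero excess at order [t] feeds the induction. *)
Let excess_eq0 t x : e t * S t - a t * S t.-1 = 0 -> F t x = C t * W * nrm2 x ^+ t.
Proof.
elim: t => [_|t IH].
  by rewrite /C big_ord0 mul1r mulr1; apply: eq_bigr => i _; rewrite mulr1.
have [P [-> PF]] := excess_rec t => /eqP.
have P2_ge0 : 0 <= \sum_f P f ^+ 2 by apply: sumr_ge0 => f _; rewrite sqr_ge0.
rewrite paddr_eq0; last 2 first.
- by rewrite mulr_ge0 // ltW.
- by apply: mulr_ge0 (excess_ge0 t); rewrite divr_ge0 // ltW.
have /gt_eqF ratio_neq0 : 0 < a t.+1 / e t.+1 by rewrite divr_gt0.
rewrite mulf_eq0 (gt_eqF (e_gt0 t)) [X in _ && X]mulf_eq0 ratio_neq0 /= => /andP[/eqP P0 /eqP/IH Ft].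
have Pf0 f : P f = 0.
  apply/eqP; rewrite -sqrf_eq0; apply/eqP.
  by apply: (psumr_eq0P _ P0) => // ? _; rewrite sqr_ge0.
have := PF x; rewrite big1 => [|f _]; last by rewrite Pf0 mul0r.
move/esym/eqP; rewrite subr_eq0 => /eqP ->; rewrite Ft exprS.
have e_neq0 : e t.+1 != 0 by rewrite gt_eqF.
have -> : C t.+1 = C t * a t.+1 / e t.+1 by rewrite -CS mulfK.
by field.
Qed.

(** Apply [lap] to both sides of the identity and cancel [a t.+1]. *)
Let design_pred t : (forall x, F t.+1 x = C t.+1 * W * nrm2 x ^+ t.+1) ->
  forall x, F t x = C t * W * nrm2 x ^+ t.
Proof.
move=> id x; have [d [wt [_ lapF _ lapq]]] := lap_F t.
have a_neq0 : a t.+1 != 0 by rewrite gt_eqF.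
apply: (mulfI a_neq0); rewrite -lapF.
rewrite (@lap_sum _ _ 'I_1 (fun=> C t.+1 * W)
          (fun=> fun y => nrm2 y ^+ t.+1)); last by move=> y; rewrite big_ord1 id.
transitivity (C t.+1 * e t.+1 * W * nrm2 x ^+ t).
  by rewrite big_ord1 lapq; ring.
by rewrite CS; ring.
Qed.

Let design_moment t : (forall x, F t x = C t * W * nrm2 x ^+ t) -> S t = C t * W ^+ 2.
Proof.
move=> id; rewrite -SF expr2 mulrA {2}/W mulr_sumr.
by apply: eq_bigr => i _; rewrite id u_unit expr1n; ring.
Qed.

Lemma kernel_designs t :
  let lhs := \sum_i \sum_j w i * w j * K (u i) (u j) ^+ t.+1 in
  let rhs := (c + 2 * t%:R) / (n + 2 * t%:R) *
             \sum_i \sum_j w i * w j * K (u i) (u j) ^+ t in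
  let identity s := forall x,
    \sum_i w i * K (u i) x ^+ s =
    (\prod_(k < s) ((c + 2 * k%:R) / (n + 2 * k%:R))) * (\sum_i w i) * nrm2 x ^+ s in
  [/\ lhs >= rhs, lhs = rhs <-> identity t.+1
    & identity t.+1 -> forall s, (s <= t.+1)%N -> identity s].
Proof.
move=> lhs rhs identity.
have e_neq0 : e t.+1 != 0 by rewrite gt_eqF.
have excessE : e t.+1 * S t.+1 - a t.+1 * S t = e t.+1 * (lhs - rhs).
  have -> : lhs = S t.+1 by [].
  have -> : rhs = (c + 2 * t%:R) / (n + 2 * t%:R) * S t by [].
  rewrite /e /a -[t.+1%:R]natr1 addrK.
  have : n + 2 * t%:R != 0 by rewrite gt_eqF // ltr_wpDr // mulr_ge0 ?ler0n.
  by move=> nz; field.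
split; first by have := excess_ge0 t.+1; rewrite /= excessE pmulr_rge0 // subr_ge0.
  split=> [eqlr x|id]; first by apply: excess_eq0; rewrite /= excessE eqlr subrr mulr0.
  apply/eqP; rewrite -subr_eq0 -(mulrI_eq0 _ (mulfI e_neq0)) -excessE.
  (* The identity at orders [t.+1] and [t] gives both moments as [C * W ^+ 2], and [CS] makes the
     excess zero. *)
  rewrite (design_moment id) (design_moment (design_pred id)).
  by rewrite mulrA [e _ * _]mulrC CS mulrA [C _ * a _]mulrC subrr.
move=> id s les; move: id; rewrite -(subnKC les).
move: (t.+1 - s)%N => r; elim: r s {les} => [|r IH] s; first by rewrite addn0.
by rewrite addnS -addSn => /IH; exact: design_pred.
Qed.

End Points.
End KernelDesigns.

(** * The real space *)

Section RealInstance.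
Variables (R : realType) (m : nat).
Implicit Types u v x : 'rV[R]_m.

Let rshift (k : 'I_m) (s : R) x := x + s *: delta_mx 0 k.

Lemma rdot_shift k s u x : rdot u (rshift k s x) = rdot u x + s * u 0 k.
Proof.
rewrite /rdot (bigD1 k) //= [in RHS](bigD1 k) //= !mxE !eqxx /= mulr1.
under eq_bigr => i /negPf ne_i do rewrite !mxE ne_i andbF mulr0 addr0.
by ring.
Qed.

Lemma rdotC u v : rdot u v = rdot v u.
Proof. by apply: eq_bigr => k _; rewrite mulrC. Qed.

Lemma rdot_ge0 x : 0 <= rdot x x.
Proof. by apply: sumr_ge0 => k _; rewrite -expr2 sqr_ge0. Qed.

(** The features are the entries of the rank-one matrix [x^T x], paired by the Frobenius product. *)
Lemma rdot_sqr u v :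
  rdot u v ^+ 2 = \sum_(a : 'I_m * 'I_m) (u 0 a.1 * u 0 a.2) * (v 0 a.1 * v 0 a.2).
Proof.
rewrite expr2 mulr_suml -(pair_big predT predT (fun j k => u 0 j * u 0 k * (v 0 j * v 0 k))) /=.
apply: eq_bigr => j _; rewrite mulr_sumr; apply: eq_bigr => k _; ring.
Qed.

Lemma real_designs (N : nat) (u : 'I_N -> 'rV[R]_m) (w : 'I_N -> R) t :
  (0 < m)%N -> (forall i, rdot (u i) (u i) = 1) ->
  let lhs := \sum_i \sum_j w i * w j * (rdot (u i) (u j) ^+ 2) ^+ t.+1 in
  let rhs := (1 + 2 * t%:R) / (m%:R + 2 * t%:R) *
             \sum_i \sum_j w i * w j * (rdot (u i) (u j) ^+ 2) ^+ t in
  let identity s := forall x,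
    \sum_i w i * (rdot (u i) x ^+ 2) ^+ s =
    (\prod_(k < s) ((1 + 2 * k%:R) / (m%:R + 2 * k%:R))) * (\sum_i w i) *
    rdot x x ^+ s in
  [/\ lhs >= rhs, lhs = rhs <-> identity t.+1
    & identity t.+1 -> forall s, (s <= t.+1)%N -> identity s].
Proof.
move=> m_gt0 u1.
apply: (@kernel_designs R _ _ _ (fun a x => x 0 a.1 * x 0 a.2) (fun x => rdot x x)
  rshift (fun k x => x 0 k) (fun k v x => rdot v x * v 0 k) (fun k v => v 0 k ^+ 2)
  (fun v x => rdot v x ^+ 2)) => //.
- exact: rdot_sqr.
- by rewrite card_ord.
- by rewrite ltr0n.
- by move=> k s x; rewrite rdot_shift rdotC rdot_shift !mxE !eqxx /=; ring.
- by move=> k s v x; rewrite rdot_shift; ring.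
- by move=> v x; rewrite /rdot expr2 mulr_sumr; apply: eq_bigr => k _; ring.
- by move=> v x; rewrite mulr_suml; apply: eq_bigr => k _; ring.
- by move=> v; rewrite mul1r.
Qed.

End RealInstance.

(** * The complex space as a real space of dimension [2 * m] *)

Section ComplexInstance.
Variables (R : realType) (m : nat).
Implicit Types u v x : 'rV[R[i]]_m.

Let re := @complex.Re R.
Let im := @complex.Im R.

Lemma dotmx_re u v : re (dotmx u v) =
  \sum_k (re (u 0 k) * re (v 0 k) + im (u 0 k) * im (v 0 k)).
Proof.
rewrite dotmxE mxE (big_morph re (id1 := 0) (op1 := +%R)) //; last by case=> [? ?] [? ?].
apply: eq_bigr => k _; rewrite !mxE.
by case: (u 0 k) (v 0 k) => [a b] [c d] /=; ring.
Qed.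

Lemma dotmx_im u v : im (dotmx u v) =
  \sum_k (im (u 0 k) * re (v 0 k) - re (u 0 k) * im (v 0 k)).
Proof.
rewrite dotmxE mxE (big_morph im (id1 := 0) (op1 := +%R)) //; last by case=> [? ?] [? ?].
apply: eq_bigr => k _; rewrite !mxE.
by case: (u 0 k) (v 0 k) => [a b] [c d] /=; ring.
Qed.

Lemma cdot_abs_sqr u v : cdot_abs u v ^+ 2 = re (dotmx u v) ^+ 2 + im (dotmx u v) ^+ 2.
Proof.
rewrite /cdot_abs /re /im; case: (dotmx u v) => a b /=.
by rewrite sqr_sqrtr // addr_ge0 ?sqr_ge0.
Qed.

(* [(k, true)] and [(k, false)] are the real and imaginary directions of the
   [k]-th coordinate. *)
Let cshift (d : 'I_m * bool) (s : R) x :=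
  x + (if d.2 then s%:C%C else (0 +i* s)%C) *: delta_mx 0 d.1.

Let xi (d : 'I_m * bool) x := if d.2 then re (x 0 d.1) else im (x 0 d.1).

(** [dotmx] is conjugate linear on the right, so a shift by [s] adds [s * u_k] to [dotmx u x] in the
    real direction and [- i * s * u_k] in the imaginary one; [beta] is half the resulting linear
    coefficient of the squared modulus. *)
Let beta (d : 'I_m * bool) u x :=
  if d.2 then re (dotmx u x) * re (u 0 d.1) + im (dotmx u x) * im (u 0 d.1)
  else re (dotmx u x) * im (u 0 d.1) - im (dotmx u x) * re (u 0 d.1).

Let gam (d : 'I_m * bool) u := re (u 0 d.1) ^+ 2 + im (u 0 d.1) ^+ 2.

Lemma sum_directions (f : 'I_m * bool -> R) :
  \sum_d f d = \sum_k (f (k, true) + f (k, false)).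
Proof.
rewrite (eq_bigr (fun d => f (d.1, d.2))); last by case.
rewrite -(pair_big predT predT (fun k b => f (k, b))) /=.
by apply: eq_bigr => k _; rewrite big_bool.
Qed.

(* Entries of the Hermitian matrix [x^* x], whose real inner product with
   that of [y] is [|<x, y>| ^ 2]. *)
Let herm (a : ('I_m * 'I_m) * bool) x :=
  if a.2 then re (x 0 a.1.1) * re (x 0 a.1.2) + im (x 0 a.1.1) * im (x 0 a.1.2)
  else im (x 0 a.1.1) * re (x 0 a.1.2) - re (x 0 a.1.1) * im (x 0 a.1.2).

Let re_cshift d s x j :
  re (cshift d s x 0 j) = re (x 0 j) + (if d.2 then s else 0) * (j == d.1)%:R.
Proof.
rewrite !mxE; case: (x 0 j) d => [a b] [k []] /=; case: (j == k) => /=; ring.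
Qed.

Let im_cshift d s x j :
  im (cshift d s x 0 j) = im (x 0 j) + (if d.2 then 0 else s) * (j == d.1)%:R.
Proof.
rewrite !mxE; case: (x 0 j) d => [a b] [k []] /=; case: (j == k) => /=; ring.
Qed.

Let re_dotmx_shift d s u x : re (dotmx u (cshift d s x)) =
  re (dotmx u x) + s * (if d.2 then re (u 0 d.1) else im (u 0 d.1)).
Proof.
rewrite !dotmx_re (bigD1 d.1) //= [in RHS](bigD1 d.1) //= re_cshift im_cshift eqxx /=.
under eq_bigr => i /negPf ne_i do rewrite re_cshift im_cshift ne_i !mulr0 !addr0.
by case: d.2; ring.
Qed.

Let im_dotmx_shift d s u x : im (dotmx u (cshift d s x)) =
  im (dotmx u x) + s * (if d.2 then im (u 0 d.1) else - re (u 0 d.1)).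
Proof.
rewrite !dotmx_im (bigD1 d.1) //= [in RHS](bigD1 d.1) //= re_cshift im_cshift eqxx /=.
under eq_bigr => i /negPf ne_i do rewrite re_cshift im_cshift ne_i !mulr0 !addr0.
by case: d.2; ring.
Qed.

Let nrm2_shift d s x :
  re (dotmx (cshift d s x) (cshift d s x)) =
  re (dotmx x x) + 2 * xi d x * s + s ^+ 2.
Proof.
rewrite !dotmx_re (bigD1 d.1) //= [in RHS](bigD1 d.1) //= re_cshift im_cshift eqxx /=.
under eq_bigr => i /negPf ne_i do rewrite re_cshift im_cshift ne_i !mulr0 !addr0.
by rewrite /xi; case: d.2; ring.
Qed.

Lemma cdot_abs_features u v :
  cdot_abs u v ^+ 2 = \sum_a herm a u * herm a v.
Proof.
rewrite cdot_abs_sqr (eq_bigr (fun a => herm (a.1, a.2) u * herm (a.1, a.2) v)); last by case.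
rewrite -(pair_big predT predT (fun a b => herm (a, b) u * herm (a, b) v)) /=.
under [RHS]eq_bigr => a _ do rewrite big_bool.
rewrite (eq_bigr (fun a => \sum_b herm ((a.1, a.2), b) u * herm ((a.1, a.2), b) v)); last first.
  by case=> j k _; rewrite big_bool.
rewrite -(pair_big predT predT
  (fun j k => \sum_b herm ((j, k), b) u * herm ((j, k), b) v)) /=.
rewrite dotmx_re dotmx_im !expr2 !mulr_suml -big_split; apply: eq_bigr => j _ /=.
rewrite !mulr_sumr -big_split; apply: eq_bigr => k _ /=.
by rewrite big_bool /herm /=; ring.
Qed.

Lemma complex_designs (N : nat) (u : 'I_N -> 'rV[R[i]]_m) (w : 'I_N -> R) t :
  (0 < m)%N -> (forall i, re (dotmx (u i) (u i)) = 1) ->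
  let lhs := \sum_i \sum_j w i * w j * (cdot_abs (u i) (u j) ^+ 2) ^+ t.+1 in
  let rhs := (2 + 2 * t%:R) / ((2 * m)%:R + 2 * t%:R) *
             \sum_i \sum_j w i * w j * (cdot_abs (u i) (u j) ^+ 2) ^+ t in
  let identity s := forall x,
    \sum_i w i * (cdot_abs (u i) x ^+ 2) ^+ s =
    (\prod_(k < s) ((2 + 2 * k%:R) / ((2 * m)%:R + 2 * k%:R))) * (\sum_i w i) *
    re (dotmx x x) ^+ s in
  [/\ lhs >= rhs, lhs = rhs <-> identity t.+1
    & identity t.+1 -> forall s, (s <= t.+1)%N -> identity s].
Proof.
move=> m_gt0 u1.
apply: (@kernel_designs R _ _ _ herm (fun x => re (dotmx x x))
  cshift xi beta gam (fun v x => cdot_abs v x ^+ 2)) => //.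
- exact: cdot_abs_features.
- by rewrite card_prod card_ord card_bool mulnC.
- by rewrite ltr0n muln_gt0.
- by move=> d s v x; rewrite !cdot_abs_sqr re_dotmx_shift im_dotmx_shift
    /beta /gam; case: d.2; ring.
- by move=> x; rewrite sum_directions dotmx_re; apply: eq_bigr => k _; rewrite /xi /=; ring.
- move=> v x; rewrite sum_directions cdot_abs_sqr !expr2 {2}dotmx_re {2}dotmx_im.
  rewrite !mulr_sumr -big_split; apply: eq_bigr => k _.
  by rewrite /xi /beta /=; ring.
(* Two-square identity: the real and imaginary directions of coordinate [k] together contribute
   [|<v, x>|^2 * |v_k|^2]. *)
- move=> v x; rewrite sum_directions cdot_abs_sqr [X in X * _]dotmx_re mulr_suml.
  by apply: eq_bigr => k _; rewrite /beta /=; ring.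
- move=> v; rewrite sum_directions dotmx_re mulr_sumr.
  by apply: eq_bigr => k _; rewrite /gam /=; ring.
Qed.

End ComplexInstance.

(** * The constants in product form, and the theorem *)

Lemma rconstE (R : realType) m t :
  rconst R m t = \prod_(k < t) ((1 + 2 * k%:R) / (m%:R + 2 * k%:R)).
Proof.
rewrite /rconst prodf_div; congr (_ / _); apply: eq_bigr => k _.
  by rewrite natrD natrM addrC.
by rewrite natrD natrM.
Qed.

(** Absorption, [(t + 1) * 'C(m + t, t + 1) = (m + t) * 'C(m + t - 1, t)], makes each new factor
    [(t + 1) / (m + t)]. *)
Lemma cconstE (R : realType) m t : (0 < m)%N ->
  cconst R m t = \prod_(k < t) ((2 + 2 * k%:R) / ((2 * m)%:R + 2 * k%:R)).
Proof.
move=> m_gt0; rewrite /cconst.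
elim: t => [|t IH]; first by rewrite big_ord0 bin0 invr1.
rewrite big_ord_recr /= -IH addnS subn1 /=.
have bin_rec : t.+1%:R * ('C(m + t, t.+1))%:R = (m%:R + t%:R) * ('C(m + t - 1, t))%:R :> R.
  by rewrite -natrD -!natrM -mul_bin_diag subn1.
have nz1 : ('C(m + t, t.+1))%:R != 0 :> R.
  by rewrite pnatr_eq0 -lt0n bin_gt0 -add1n leq_add2r.
have nz2 : ('C(m + t - 1, t))%:R != 0 :> R.
  by rewrite pnatr_eq0 -lt0n bin_gt0 -addnBAC // leq_addl.
have nz3 : m%:R + t%:R != 0 :> R by rewrite -natrD pnatr_eq0 -lt0n addn_gt0 m_gt0.
apply: (mulIf nz1); rewrite mulVf // natrM.
have -> : 2 * m%:R + 2 * t%:R = 2 * (m%:R + t%:R) :> R by ring.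
apply: (mulIf nz2); apply: (mulIf nz3).
transitivity (t.+1%:R * ('C(m + t, t.+1))%:R : R); first by rewrite bin_rec; ring.
by rewrite -natr1; field; rewrite nz2 nz3.
Qed.

Theorem theorem2p1 (R : realType) (m N : nat) (m_ge1 : (1 <= m)%N)
    (N_ge1 : (1 <= N)%N) (w : 'I_N -> R) :
  (forall u : 'I_N -> 'rV[R]_m, (forall i, rnorm (u i) = 1) ->
   forall t : nat, (1 <= t)%N ->
   let lhs := \sum_(i < N) \sum_(j < N)
                w i * w j * `|rdot (u i) (u j)| ^+ (2 * t) in
   let rhs := (2 * t - 1)%N%:R / (m + 2 * t - 2)%N%:R *
              \sum_(i < N) \sum_(j < N)
                w i * w j * `|rdot (u i) (u j)| ^+ (2 * t - 2) in
   let identity s := forall x : 'rV[R]_m,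
     \sum_(i < N) w i * `|rdot (u i) x| ^+ (2 * s) =
     rconst R m s * (\sum_(i < N) w i) * rnorm x ^+ (2 * s) in
   [/\ lhs >= rhs,
       lhs = rhs <-> identity t
     & identity t -> forall s : nat, (1 <= s <= t)%N -> identity s])
  /\
  (forall u : 'I_N -> 'rV[R[i]]_m, (forall i, cnorm (u i) = 1) ->
   forall t : nat, (1 <= t)%N ->
   let lhs := \sum_(i < N) \sum_(j < N)
                w i * w j * cdot_abs (u i) (u j) ^+ (2 * t) in
   let rhs := t%:R / (m + t - 1)%N%:R *
              \sum_(i < N) \sum_(j < N)
                w i * w j * cdot_abs (u i) (u j) ^+ (2 * t - 2) in
   let identity s := forall x : 'rV[R[i]]_m,
     \sum_(i < N) w i * cdot_abs (u i) x ^+ (2 * s) =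
     cconst R m s * (\sum_(i < N) w i) * cnorm x ^+ (2 * s) in
   [/\ lhs >= rhs,
       lhs = rhs <-> identity t
     & identity t -> forall s : nat, (1 <= s <= t)%N -> identity s]).
Proof.
(* With the order written [t.+1], the truncated subtractions are exact; even powers then turn norms
   and moduli into the squares used by the two instances. *)
split=> u u1 [//|t] _ lhs rhs identity.
- have norm_exp x s : rnorm x ^+ (2 * s) = rdot x x ^+ s.
    by rewrite exprM /rnorm sqr_sqrtr // rdot_ge0.
  have abs_exp (r : R) s : `|r| ^+ (2 * s) = (r ^+ 2) ^+ s.
    by rewrite exprM real_normK // num_real.
  have u1' i : rdot (u i) (u i) = 1 by rewrite -[LHS]expr1 -norm_exp u1 expr1n.
  have [ge_lr eq_lr descent] := real_designs w t m_ge1 u1'.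
  have lhsE : lhs = \sum_i \sum_j w i * w j * (rdot (u i) (u j) ^+ 2) ^+ t.+1.
    by apply: eq_bigr => i _; apply: eq_bigr => j _; rewrite abs_exp.
  have rhsE : rhs = (1 + 2 * t%:R) / (m%:R + 2 * t%:R) *
             \sum_i \sum_j w i * w j * (rdot (u i) (u j) ^+ 2) ^+ t.
    rewrite /rhs; have [-> -> ->] : [/\ 2 * t.+1 - 1 = 1 + 2 * t, m + 2 * t.+1 - 2 = m + 2 * t
      & 2 * t.+1 - 2 = 2 * t]%N by split; lia.
    rewrite [(1 + _)%:R]natrD [(m + _)%:R]natrD natrM; congr (_ * _).
    by apply: eq_bigr => i _; apply: eq_bigr => j _; rewrite abs_exp.
  have idP s : identity s <-> forall x, \sum_i w i * (rdot (u i) x ^+ 2) ^+ s =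
    (\prod_(k < s) ((1 + 2 * k%:R) / (m%:R + 2 * k%:R))) * (\sum_i w i) *
    rdot x x ^+ s.
    have sumE x : \sum_i w i * `|rdot (u i) x| ^+ (2 * s) =
        \sum_i w i * (rdot (u i) x ^+ 2) ^+ s.
      by apply: eq_bigr => i _; rewrite abs_exp.
    by rewrite -rconstE; split=> id x; have := id x; rewrite norm_exp sumE.
  split; first by rewrite lhsE rhsE.
    by rewrite lhsE rhsE idP.
  by move=> /idP/descent id s /andP[_ les]; apply/idP/id.
- have norm_exp x s : cnorm x ^+ (2 * s) = complex.Re (dotmx x x) ^+ s.
    rewrite exprM /cnorm sqr_sqrtr // dotmx_re.
    by apply: sumr_ge0 => k _; rewrite -!expr2 addr_ge0 ?sqr_ge0.
  have u1' i : complex.Re (dotmx (u i) (u i)) = 1.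
    by rewrite -[LHS]expr1 -norm_exp u1 expr1n.
  have [ge_lr eq_lr descent] := complex_designs w t m_ge1 u1'.
  have lhsE : lhs = \sum_i \sum_j w i * w j * (cdot_abs (u i) (u j) ^+ 2) ^+ t.+1.
    by apply: eq_bigr => i _; apply: eq_bigr => j _; rewrite exprM.
  have rhsE : rhs = (2 + 2 * t%:R) / ((2 * m)%:R + 2 * t%:R) *
             \sum_i \sum_j w i * w j * (cdot_abs (u i) (u j) ^+ 2) ^+ t.
    rewrite /rhs; have [-> ->] : [/\ m + t.+1 - 1 = m + t & 2 * t.+1 - 2 = 2 * t]%N by split; lia.
    congr (_ * _).
      have nz : m%:R + t%:R != 0 :> R by rewrite -natrD pnatr_eq0 -lt0n addn_gt0 m_ge1.
      by rewrite natrM natrD -natr1 -[2 * _ + _]mulrDr; field; rewrite nz.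
    by apply: eq_bigr => i _; apply: eq_bigr => j _; rewrite exprM.
  have idP s : identity s <-> forall x, \sum_i w i * (cdot_abs (u i) x ^+ 2) ^+ s =
    (\prod_(k < s) ((2 + 2 * k%:R) / ((2 * m)%:R + 2 * k%:R))) * (\sum_i w i) *
    complex.Re (dotmx x x) ^+ s.
    have sumE x : \sum_i w i * cdot_abs (u i) x ^+ (2 * s) =
        \sum_i w i * (cdot_abs (u i) x ^+ 2) ^+ s.
      by apply: eq_bigr => i _; rewrite exprM.
    by rewrite -cconstE //; split=> id x; have := id x; rewrite norm_exp sumE.
  split; first by rewrite lhsE rhsE.
    by rewrite lhsE rhsE idP.
  by move=> /idP/descent id s /andP[_ les]; apply/idP/id.
Qed.
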